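(* Let $r>s\ge 1$ be fixed integers. Then $$\limsup_{n\to\infty}q^*(G(n,r,s))\le\frac{s}{r}.$$
   Context: For integers $n,r,s$, the Johnson graph $G(n,r,s)$ has as vertices all vectors $v\in\{0,1\}^n$ with exactly $r$ ones; two vertices are joined by an edge if and only if their inner product equals $s$. Modularity: for a graph $G$ with $e(G)$ edges and a partition $\mathcal{A}$ of its vertex set, $q(\mathcal{A})=\sum_{A\in\mathcal{A}}\frac{e(A)}{e(G)}-\sum_{A\in\mathcal{A}}\frac{(\sum_{v\in A}\deg(v))^2}{4e(G)^2}$, where $e(A)$ is the number of edges of $G$ with both endpoints in $A$. The modularity of $G$ is $q^*(G)=\max_{\mathcal{A}}q(\mathcal{A})$, over all partitions of the vertex set. *)

(* Defs.v *)
From mathcomp Require Import all_boot all_order all_algebra.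

Set Implicit Arguments.
Unset Strict Implicit.
Unset Printing Implicit Defensive.

Import Order.TTheory GRing.Theory Num.Theory.

Local Open Scope ring_scope.

Record sgraph := SGraph {
  vertex :> finType;
  adj : rel vertex;
  adj_sym : symmetric adj;
  adj_irrefl : irreflexive adj
}.

Section Modularity.
Variables (R : realFieldType) (G : sgraph).
Implicit Types (A : {set G}) (P : {set {set G}}).

Definition edges : {set {set G}} :=
  [set [set p.1; p.2] | p : G * G & adj p.1 p.2].

Definition deg (v : G) : nat := #|[set w | adj v w]|.

Definition edges_in A : {set {set G}} := [set E in edges | E \subset A].

(* If [G] has no edges, division by 0 makes this 0. *)
Definition modularity_score P : R :=
  \sum_(A in P) (#|edges_in A|%:R / #|edges|%:R)
  - \sum_(A in P)
      ((\sum_(v in A) deg v)%N%:R ^+ 2 / (4%:R * #|edges|%:R ^+ 2)).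

Definition discrete_partition : {set {set G}} := [set [set v] | v : G].

(* [discrete_partition] only witnesses that partitions exist, see
   [modularity_attained] and [modularity_ub]. *)
Definition modularity : R :=
  modularity_score
    [arg max_(P > discrete_partition | partition P [set: G])
       modularity_score P]%O.

Lemma discrete_partitionP : partition discrete_partition [set: G].
Proof.
apply/and3P; split.
- by rewrite eqEsubset subsetT; apply/subsetP=> v _; apply/bigcupP;
    exists [set v]; rewrite ?set11 ?imset_f.
- apply/trivIsetP=> _ _ /imsetP[v _ ->] /imsetP[w _ ->] vw.
  by rewrite disjoints1 inE; apply: contraNneq vw => ->.
- apply/imsetP=> -[v _ /setP/(_ v)]; by rewrite !inE eqxx.
Qed.

Lemma modularity_attained :
  exists2 P, partition P [set: G] & modularity = modularity_score P.
Proof.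
rewrite /modularity; case: arg_maxP => [|P PP _]; last by exists P.
exact: discrete_partitionP.
Qed.

Lemma modularity_ub P :
  partition P [set: G] -> modularity_score P <= modularity.
Proof.
rewrite /modularity; case: arg_maxP => [|Q _ maxQ]; last exact: maxQ.
exact: discrete_partitionP.
Qed.

End Modularity.

Section Johnson.
Variables n r s : nat.

Definition johnson_vertex : finType :=
  {v : {ffun 'I_n -> bool} | #|[set i | v i]| == r}.

Definition inner (v w : {ffun 'I_n -> bool}) : nat :=
  (\sum_(i < n) v i * w i)%N.

(* The condition [v != w] only matters for [s = r], since
   [inner (val v) (val v) = r]. *)
Definition johnson_adj : rel johnson_vertex :=
  fun v w => (v != w) && (inner (val v) (val w) == s).

Lemma johnson_adj_sym : symmetric johnson_adj.
Proof.
move=> v w; rewrite /johnson_adj eq_sym /inner; congr (_ && (_ == _)).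
by apply: eq_bigr => i _; rewrite mulnC.
Qed.

Lemma johnson_adj_irrefl : irreflexive johnson_adj.
Proof. by move=> v; rewrite /johnson_adj eqxx. Qed.

Definition johnson : sgraph := SGraph johnson_adj_sym johnson_adj_irrefl.

End Johnson.

(* Main.v *)
(** A random neighbour of [v] keeps a random [s]-subset [S] of the support and
replaces the rest, so the density of edges inside a vertex set [A] is at most
the mean over [s]-sets [S] of [h(S)^2], where [h(S)] is the proportion of
[r]-supersets of [S] that lie in [A], up to a factor tending to 1 that accounts
for the two endpoints having to meet only in [S].  The mean [a_j] of [h^2] over
[j]-sets is a convex function of [j], with [a_0 = mu^2] and [a_r = mu] for
[mu = |A| / 'C(n, r)]; hence [a_s <= mu^2 + (s/r)(mu - mu^2)].  Since the graph
is regular, the [mu^2] cancels the degree tax, and summing [(s/r) mu] over the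
parts gives [s/r] in the limit. *)

Require Import Defs.
From mathcomp Require Import classical_sets.
From mathcomp Require Import all_boot all_order all_algebra.
From mathcomp Require Import reals ereal sequences.
From mathcomp Require Import ring lra zify.

Import Order.TTheory GRing.Theory Num.Theory.

Local Open Scope ring_scope.

(** * Convexity of mean squares for functions with a mean value property *)

Section Harmonic.
Variables (R : realFieldType) (T : finType).
Implicit Types (S D : {set T}) (h F : {set T} -> R).

(** Double counting: a set of size [j.+1] arises as [x |: S] once for each choice of its element
    [x]. *)
Lemma sum_setU1 F j :
  \sum_(S : {set T} | #|S| == j) \sum_(x in ~: S) F (x |: S) =
  j.+1%:R * \sum_(S : {set T} | #|S| == j.+1) F S.
Proof.
have -> : j.+1%:R * \sum_(S : {set T} | #|S| == j.+1) F S =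
    \sum_(S : {set T} | #|S| == j.+1) \sum_(x in S) F S.
  rewrite mulr_sumr; apply: eq_bigr => S /eqP cS.
  by rewrite sumr_const cS mulr_natl.
rewrite (exchange_big_dep predT) //= [RHS](exchange_big_dep predT) //=.
apply: eq_bigr => x _.
rewrite [RHS](reindex_onto (setU [set x]) (fun S => S :\ x)) /=; last first.
  by move=> S /andP[_ xS]; rewrite setD1K.
apply: eq_bigl => S; rewrite setU11 andbT inE.
have [xS|xS] := boolP (x \in S); last by rewrite cardsU1 xS setU1K // eqxx !andbT.
rewrite andbF; apply/esym/negbTE/negP => /andP[_ /eqP eS].
by move: xS; rewrite -eS setD11.
Qed.

(** The expression is the sum over [D] of the squares of the mixed second differences
    [w x y - u x - u y + c]; the prescribed row and column sums of [w] evaluate the cross terms. *)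
Lemma sum_second_difference_ge0 (D : {set T}) (c : R) (u : T -> R)
    (w : T -> T -> R) :
  \sum_(x in D) u x = #|D|%:R * c ->
  {in D, forall x, \sum_(y in D) w x y = #|D|%:R * u x} ->
  {in D, forall y, \sum_(x in D) w x y = #|D|%:R * u y} ->
  0 <= \sum_(x in D) \sum_(y in D) w x y ^+ 2
       - 2%:R * #|D|%:R * \sum_(x in D) u x ^+ 2 + #|D|%:R ^+ 2 * c ^+ 2.
Proof.
set m : R := #|D|%:R => su swl swr.
set A := \sum_(x in D) u x ^+ 2.
have wu : \sum_(x in D) \sum_(y in D) w x y * u y = m * A.
  rewrite exchange_big mulr_sumr; apply: eq_bigr => y yD.
  by rewrite -mulr_suml swr // expr2 mulrA.
suff <- : \sum_(x in D) \sum_(y in D) (w x y - u x - u y + c) ^+ 2 =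
    \sum_(x in D) \sum_(y in D) w x y ^+ 2 - 2%:R * m * A + m ^+ 2 * c ^+ 2.
  by do 2![apply: sumr_ge0 => ? _]; exact: sqr_ge0.
have inner x : x \in D -> \sum_(y in D) (w x y - u x - u y + c) ^+ 2 =
    \sum_(y in D) w x y ^+ 2 - 2%:R * (\sum_(y in D) w x y * u y)
    + A - m * u x ^+ 2 + (2%:R * m * c) * u x - m * c ^+ 2.
  move=> xD.
  have -> : \sum_(y in D) (w x y - u x - u y + c) ^+ 2 =
     \sum_(y in D) (w x y ^+ 2 - 2%:R * (w x y * u y) + u y ^+ 2
       + 2%:R * (c - u x) * w x y - 2%:R * (c - u x) * u y + (c - u x) ^+ 2).
    by apply: eq_bigr => y _; ring.
  rewrite !big_split /= !sumrN -!mulr_sumr sumr_const swl // su -/A.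
  rewrite -[_ *+ #|D|]mulr_natr -/m; ring.
rewrite (eq_bigr _ inner) !big_split /= !sumrN -!mulr_sumr wu su !sumr_const -/A.
rewrite -[A *+ _]mulr_natr -[c *+ _]mulr_natr -/m; ring.
Qed.

Definition harmonic_below r h :=
  forall S, (#|S| < r)%N -> \sum_(x in ~: S) h (x |: S) = #|~: S|%:R * h S.

Definition mean_square h j : R :=
  (\sum_(S : {set T} | #|S| == j) h S ^+ 2) / 'C(#|T|, j)%:R.

(** Around each [j]-set [S], the second-difference bound is applied with [D = ~: S] and
    [w x y = h (y |: (x |: S))]. Summing over [S] and double counting brings in the levels [j],
    [j.+1] and [j.+2]. *)
Lemma mean_square_convex r h j :
    harmonic_below r h -> (j.+1 < r)%N -> (r <= #|T|)%N ->
  2%:R * mean_square h j.+1 <= mean_square h j + mean_square h j.+2.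
Proof.
move=> hh jr rT.
set n := #|T| in rT *.
set m : R := (n - j)%:R.
have local S : #|S| == j ->
    0 <= \sum_(x in ~: S) \sum_(y in ~: (x |: S)) h (y |: (x |: S)) ^+ 2
      - 2%:R * (m - 1) * \sum_(x in ~: S) h (x |: S) ^+ 2
      + m * (m - 1) * h S ^+ 2.
  move=> /eqP cS.
  have cCS : #|~: S| = (n - j)%N by have := cardsC S; rewrite -/n; lia.
  have D1 x : x \in ~: S -> forall F : T -> R,
      \sum_(y in ~: S) F y = F x + \sum_(y in ~: (x |: S)) F y.
    move=> xS F; rewrite (bigD1 x) //=; congr (_ + _); apply: eq_bigl => y.
    by rewrite !inE negb_or andbC.
  (* For [y = x] the summand is [h (x |: S)], so no off-diagonal restriction is
     needed to get the factor [m]. *)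
  have hx x : x \in ~: S ->
      \sum_(y in ~: S) h (y |: (x |: S)) = m * h (x |: S).
    move=> xS; rewrite (D1 x xS) setUA setUid.
    have cxS : #|x |: S| = j.+1 by rewrite cardsU1 -in_setC xS cS.
    have -> : m = 1 + #|~: (x |: S)|%:R.
      rewrite /m nat1r; congr (_%:R).
      by have := cardsC (x |: S); rewrite -/n; lia.
    by rewrite hh ?cxS //; ring.
  have h0 : \sum_(x in ~: S) h (x |: S) = m * h S.
    by rewrite hh ?cS ?cCS //; lia.
  have swl : {in ~: S, forall x,
      \sum_(y in ~: S) h (y |: (x |: S)) = #|~: S|%:R * h (x |: S)}.
    by move=> x xS; rewrite hx // cCS.
  have swr : {in ~: S, forall y,
      \sum_(x in ~: S) h (y |: (x |: S)) = #|~: S|%:R * h (y |: S)}.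
    move=> y yS; rewrite -swl //; apply: eq_bigr => x _; congr (h _).
    by rewrite setUCA.
  have su : \sum_(x in ~: S) h (x |: S) = #|~: S|%:R * h S by rewrite cCS.
  have H := sum_second_difference_ge0 _ _ _ _ su swl swr.
  rewrite cCS -/m in H.
  (* The diagonal [x = y] puts one extra copy of the first-level sum into [H]; adding this variance
     corrects the coefficients to [2 * (m - 1)] and [m * (m - 1)]. *)
  have : 0 <= \sum_(x in ~: S) (h (x |: S) - h S) ^+ 2.
    by apply: sumr_ge0 => ? _; exact: sqr_ge0.
  have -> : \sum_(x in ~: S) (h (x |: S) - h S) ^+ 2 =
      \sum_(x in ~: S) h (x |: S) ^+ 2 - m * h S ^+ 2.
    have -> : \sum_(x in ~: S) (h (x |: S) - h S) ^+ 2 =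
      \sum_(x in ~: S)
        (h (x |: S) ^+ 2 - 2%:R * h S * h (x |: S) + h S ^+ 2).
      by apply: eq_bigr => x _; ring.
    rewrite !big_split /= sumrN -mulr_sumr h0 sumr_const cCS.
    by rewrite -[_ *+ (n - j)]mulr_natr -/m; ring.
  have split2 : \sum_(x in ~: S) \sum_(y in ~: S) h (y |: (x |: S)) ^+ 2 =
      \sum_(x in ~: S) h (x |: S) ^+ 2 +
      \sum_(x in ~: S) \sum_(y in ~: (x |: S)) h (y |: (x |: S)) ^+ 2.
    rewrite -big_split /=; apply: eq_bigr => x xS.
    by rewrite (D1 x xS) setUA setUid.
  move: H; rewrite split2; set A1 := \sum_(x in _) h _ ^+ 2.
  by set A2 := \sum_(x in _) _; nra.
have : 0 <= \sum_(S : {set T} | #|S| == j)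
    (\sum_(x in ~: S) \sum_(y in ~: (x |: S)) h (y |: (x |: S)) ^+ 2
      - 2%:R * (m - 1) * \sum_(x in ~: S) h (x |: S) ^+ 2
      + m * (m - 1) * h S ^+ 2) by apply: sumr_ge0.
rewrite !big_split /= sumrN -!mulr_sumr.
rewrite (sum_setU1 (fun S => \sum_(y in ~: S) h (y |: S) ^+ 2)).
rewrite !(sum_setU1 (fun S => h S ^+ 2)).
have bE k : (k <= n)%N ->
    \sum_(S : {set T} | #|S| == k) h S ^+ 2 = 'C(n, k)%:R * mean_square h k.
  move=> kn; rewrite /mean_square mulrCA mulfV ?mulr1 //.
  by rewrite pnatr_eq0 -lt0n bin_gt0.
rewrite !bE; try lia.
have m1 : m - 1 = (n - j.+1)%:R.
  have -> : m = 1 + (n - j.+1)%:R by rewrite /m nat1r; congr (_%:R); lia.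
  by rewrite addrC addKr.
(* [c1] and [c2] bring all three levels to the common factor [(m - 1) * m * 'C(n, j)], positive
   because [j.+1 < r <= n]. *)
have c1 : j.+1%:R * 'C(n, j.+1)%:R = m * 'C(n, j)%:R :> R.
  by rewrite -!natrM mul_bin_left.
have c2 : j.+2%:R * 'C(n, j.+2)%:R = (m - 1) * 'C(n, j.+1)%:R :> R.
  by rewrite m1 -!natrM mul_bin_left.
move: (mean_square h j) (mean_square h j.+1) (mean_square h j.+2) => a0 a1 a2.
have -> : j.+1%:R * (j.+2%:R * ('C(n, j.+2)%:R * a2)) -
   2%:R * (m - 1) * (j.+1%:R * ('C(n, j.+1)%:R * a1)) +
   m * (m - 1) * ('C(n, j)%:R * a0) =
   (m - 1) * m * 'C(n, j)%:R * (a0 + a2 - 2%:R * a1).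
  rewrite !(mulrA j.+2%:R) c2.
  have -> : j.+1%:R * ((m - 1) * 'C(n, j.+1)%:R * a2) =
     (m - 1) * a2 * (j.+1%:R * 'C(n, j.+1)%:R) by ring.
  by rewrite !(mulrA j.+1%:R) c1; ring.
rewrite pmulr_rge0 ?subr_ge0 // m1 -!natrM ltr0n !muln_gt0 bin_gt0.
by apply/andP; split; lia.
Qed.

(** A convex sequence lies below its chord from [0] to [r]. *)
Lemma convex_seq_le (a : nat -> R) r s :
    (forall j, (j.+1 < r)%N -> 2%:R * a j.+1 <= a j + a j.+2) ->
    (s <= r)%N ->
  r%:R * a s <= (r - s)%:R * a 0%N + s%:R * a r.
Proof.
move=> cvx sr.
(* For [k > 0] this says that the chord slope [(a k - a 0) / k] does not decrease when [k] grows by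
   one. *)
have step k : (k < r)%N -> k%:R * a k.+1 + a 0%N >= k.+1%:R * a k.
  elim: k => [|k IH] kr; first by rewrite mul0r mul1r add0r.
  have {IH} := IH (ltnW kr); have := cvx k kr.
  have k0 : 0 <= k%:R :> R by [].
  by rewrite -(natr1 k.+1) -(natr1 k); nra.
have [->|s0] := posnP s; first by rewrite subn0 mul0r addr0.
elim: r sr {cvx} step => [|r IH]; first by case: s s0.
rewrite leq_eqVlt => /orP[/eqP <-|sr] step.
  by rewrite subnn mul0r add0r.
have {IH} := IH sr (fun k kr => step k (ltnW kr)).
have := step r (ltnSn _).
rewrite subSn // -!(natr1 r) -(natr1 (r - s)) natrB //.
have s1 : 0 < s%:R :> R by rewrite ltr0n.
have rs : s%:R <= r%:R :> R by rewrite ler_nat.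
move: (a s) (a 0%N) (a r) (a r.+1) => as' a0 ar ar1 h1 h2.
have r1 : 0 < r%:R :> R by lra.
(* After scaling by [r], the goal is [r + 1] times [h2] plus [s] times [h1]. *)
rewrite -(ler_pM2l r1).
nra.
Qed.
End Harmonic.

Arguments harmonic_below {R T}.
Arguments mean_square {R T}.

(** Edges are images of ordered adjacent pairs under [f]; irreflexivity makes every fibre consist of
    exactly two pairs. *)
Lemma card_edges_in (G : sgraph) (A : {set G}) :
  (2 * #|edges_in A| = \sum_(v in A) #|[set w in A | adj v w]|)%N.
Proof.
pose f (p : G * G) : {set G} := [set p.1; p.2].
pose P := [set p : G * G | [&& p.1 \in A, p.2 \in A & adj p.1 p.2]].
have -> : edges_in A = f @: P.
  apply/setP=> E; rewrite inE; apply/andP/imsetP => [[/imsetP[p]]|[p]].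
    rewrite inE => pe -> /subsetP sA; exists p => //.
    by rewrite inE pe !sA // !inE eqxx ?orbT.
  rewrite inE => /and3P[p1 p2 pe] ->; split.
    by apply/imsetP; exists p; rewrite ?inE.
  by apply/subsetP => x /set2P[] ->.
have -> : (\sum_(v in A) #|[set w in A | adj v w]| = #|P|)%N.
  rewrite -sum1_card; under eq_bigr do rewrite -sum1_card.
  by rewrite pair_big_dep /=; apply: eq_bigl => p; rewrite !inE.
rewrite -[RHS]sum1_card (partition_big_imset f _ (fun=> 1%N)) /=.
rewrite -sum1_card big_distrr /=; apply: eq_bigr => E /imsetP[[v w]].
rewrite inE /= => /and3P[vA wA vw] ->; rewrite muln1.
have nvw : v != w by apply: contraTneq vw => ->; rewrite adj_irrefl.
transitivity #|[set (v, w); (w, v)]|.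
  by rewrite cards2 xpair_eqE (negbTE nvw).
rewrite -sum1_card; apply: eq_bigl => -[a b].
rewrite !inE /= !xpair_eqE; apply/idP/idP.
  by case/orP => /andP[/eqP -> /eqP ->]; rewrite ?vA ?wA ?vw ?[adj w v]adj_sym
    ?vw ?[f (w, v)]setUC eqxx.
case/andP=> /and3P[_ _ ab] /eqP eab.
have : a \in f (v, w) by rewrite -eab !inE eqxx.
have : b \in f (v, w) by rewrite -eab !inE eqxx orbT.
rewrite !inE /= => /orP[]/eqP eb /orP[]/eqP ea; move: ab;
  by rewrite eb ea ?adj_irrefl ?eqxx ?orbT.
Qed.

(** * Johnson graphs through the supports of their vertices *)

Section JohnsonGraph.
Variables n r s : nat.
Implicit Types (v w : johnson_vertex n r) (A : {set johnson_vertex n r}).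
Implicit Types S : {set 'I_n}.

Definition supp v : {set 'I_n} := [set i | val v i].

Lemma card_supp v : #|supp v| = r.
Proof. exact/eqP/(valP v). Qed.

Lemma supp_inj : injective supp.
Proof.
move=> v w /setP e; apply/val_inj/ffunP => i.
by have := e i; rewrite !inE.
Qed.

Lemma supp_onto S : #|S| = r -> exists v, supp v = S.
Proof.
move=> cS.
have eS : [set i | [ffun i => i \in S] i] = S.
  by apply/setP => i; rewrite inE ffunE.
have P : #|[set i | [ffun i => i \in S] i]| == r by rewrite eS cS.
by exists (exist _ [ffun i => i \in S] P); rewrite -[RHS]eS.
Qed.

Lemma inner_supp v w : inner (val v) (val w) = #|supp v :&: supp w|.
Proof.
rewrite /inner -sum1_card [RHS]big_mkcond /=; apply: eq_bigr => i _.
by rewrite !inE; case: (val v i); case: (val w i).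
Qed.

Lemma card_johnson : #|johnson_vertex n r| = 'C(n, r).
Proof.
have := card_draws 'I_n r; rewrite card_ord => <-.
rewrite -(card_imset _ supp_inj); apply: eq_card => S; rewrite inE.
apply/imsetP/eqP => [[v _ ->]|/supp_onto[v <-]]; first exact: card_supp.
by exists v.
Qed.

(** A support meets itself in [r > s] points, so the intersection size alone already excludes
    [v = w]. *)
Lemma johnson_adjE v w : (s < r)%N ->
  johnson_adj s v w = (#|supp v :&: supp w| == s).
Proof.
move=> sr; rewrite /johnson_adj inner_supp.
have [->|//] := eqVneq v w; rewrite setIid card_supp.
by apply/esym/negbTE; rewrite gtn_eqF.
Qed.

(** A neighbour is determined by its [s] points inside [supp v] and its [r - s] points outside,
    chosen independently. *)
Lemma deg_johnson (v : johnson n r s) : (s < r)%N ->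
  deg v = ('C(r, s) * 'C(n - r, r - s))%N.
Proof.
move=> sr.
pose D1 := [set B : {set 'I_n} | B \subset supp v & #|B| == s].
pose D2 := [set B : {set 'I_n} | B \subset ~: supp v & #|B| == (r - s)%N].
have cC : #|~: supp v| = (n - r)%N by rewrite cardsCs setCK card_ord card_supp.
have -> : ('C(r, s) * 'C(n - r, r - s) = #|setX D1 D2|)%N.
  by rewrite cardsX !cards_draws card_supp cC.
pose f (p : {set 'I_n} * {set 'I_n}) := p.1 :|: p.2.
have fI p : p \in setX D1 D2 ->
    (f p :&: supp v = p.1) /\ (f p :\: supp v = p.2).
  case: p => B C; rewrite !inE /= /f /= => /andP[/andP[BV _] /andP[CV _]].
  rewrite setIUl setDUl (setIidPl BV).
  move: CV; rewrite -disjoints_subset => dCV.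
  rewrite (disjoint_setI0 dCV) setU0; split=> //.
  by move: BV; rewrite -setD_eq0 => /eqP ->; rewrite set0U; apply/setDidPl.
have inj : {in setX D1 D2 &, injective f}.
  move=> p q /fI [p1 p2] /fI [q1 q2] fpq.
  by apply/eqP; rewrite -pair_eqE /pair_eq -p1 -p2 -q1 -q2 fpq !eqxx.
rewrite /deg -(card_imset _ supp_inj) -(card_in_imset inj).
apply: eq_card => W; apply/imsetP/imsetP => [[w]|[[B C]]].
  rewrite inE /= johnson_adjE // => /eqP e ->.
  exists (supp w :&: supp v, supp w :\: supp v); last by rewrite /f /= setID.
  rewrite !inE /= subsetIr setDE subsetIr setIC e eqxx /=.
  by rewrite -setDE cardsD card_supp setIC e eqxx.
move=> BC; have [/= f1 f2] := fI _ BC.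
move: BC; rewrite !inE /= => /andP[/andP[BV /eqP cB] /andP[CV /eqP cC']].
have cf : #|f (B, C)| = r.
  by rewrite -(cardsID (supp v)) f1 f2 cB cC' subnKC // ltnW.
have [w ew] := supp_onto _ cf; exists w; last by rewrite ew.
by rewrite inE /= johnson_adjE // ew setIC f1 cB.
Qed.

Lemma card_edges_johnson : (s < r)%N ->
  (2 * #|edges (johnson n r s)| = 'C(n, r) * ('C(r, s) * 'C(n - r, r - s)))%N.
Proof.
move=> sr; have -> : edges (johnson n r s) = edges_in [set: johnson n r s].
  by apply/setP => E; rewrite inE subsetT andbT.
rewrite card_edges_in -card_johnson -cardsT -sum_nat_const.
apply: eq_bigr => v _.
by rewrite -[RHS](deg_johnson v sr); apply: eq_card => w; rewrite !inE.
Qed.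

(** * Degrees of sets in the hypergraph of supports, and their densities *)

Definition link A S : nat := #|[set v in A | S \subset supp v]|.

Lemma linkE A S : link A S = (\sum_(v in A) (S \subset supp v))%N.
Proof.
rewrite /link -sum1_card big_mkcond [RHS]big_mkcond /=; apply: eq_bigr => v _.
by rewrite inE; case: (v \in A); case: (S \subset _).
Qed.

(** Each [v] counted by [link A S] is counted again for every one of the [r - #|S|] points of
    [supp v] outside [S]. *)
Lemma sum_link_setU1 A S :
  (\sum_(x in ~: S) link A (x |: S) = (r - #|S|) * link A S)%N.
Proof.
under eq_bigr do rewrite linkE.
rewrite exchange_big linkE big_distrr /=; apply: eq_bigr => v _.
have [Sv|nSv] := boolP (S \subset supp v); last first.
  rewrite muln0 big1 // => x _.
  by rewrite subUset (negbTE nSv) andbF.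
rewrite muln1 -(card_supp v) -[in RHS](setIidPr Sv) -cardsD -sum1_card.
rewrite big_mkcond [RHS]big_mkcond /=; apply: eq_bigr => x _.
by rewrite !inE subUset Sv andbT sub1set inE; case: (x \in S); case: (val v x).
Qed.

(** The square counts pairs of vertices of [A] whose supports both contain [S]; exchanging sums
    counts the [j]-subsets of the intersection. *)
Lemma sum_link_sqr A j :
  (\sum_(S : {set 'I_n} | #|S| == j) link A S ^ 2 =
   \sum_(v in A) \sum_(w in A) 'C(#|supp v :&: supp w|, j))%N.
Proof.
transitivity (\sum_(S : {set 'I_n} | #|S| == j) \sum_(v in A) \sum_(w in A)
    (S \subset supp v :&: supp w))%N.
  apply: eq_bigr => S _; rewrite linkE -mulnn big_distrl /=.
  apply: eq_bigr => v _; rewrite big_distrr /=; apply: eq_bigr => w _.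
  by rewrite subsetI mulnb.
rewrite exchange_big; apply: eq_bigr => v _ /=.
rewrite exchange_big; apply: eq_bigr => w _ /=.
rewrite -cards_draws -sum1_card big_mkcond [RHS]big_mkcond /=.
apply: eq_bigr => S _; rewrite inE.
by case: (S \subset _); case: (#|S| == j).
Qed.

(** An adjacent pair shares exactly one [s]-set; pairs meeting in more points only enlarge the
    right-hand side. *)
Lemma sum_adj_le A : (s < r)%N ->
  (\sum_(v in A) #|[set w in A | johnson_adj s v w]| <=
   \sum_(S : {set 'I_n} | #|S| == s) link A S ^ 2)%N.
Proof.
move=> sr; rewrite sum_link_sqr; apply: leq_sum => v _.
rewrite -sum1_card big_mkcond [leqRHS]big_mkcond /=; apply: leq_sum => w _.
rewrite inE johnson_adjE //; case: (w \in A) => //=.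
by case: eqP => // ->; rewrite binn.
Qed.

(** For [#|S| <= r <= n] the denominator is the number of [r]-sets containing [S], so this is the
    proportion of them that are supports of vertices in [A]. *)
Definition density (R : realFieldType) A S : R :=
  (link A S)%:R / 'C(n - #|S|, r - #|S|)%:R.

Lemma harmonic_density (R : realFieldType) A : (r <= n)%N ->
  harmonic_below r (density R A).
Proof.
move=> rn S Sr.
have cC : #|~: S| = (n - #|S|)%N by rewrite cardsCs setCK card_ord.
have -> : \sum_(x in ~: S) density R A (x |: S) =
    \sum_(x in ~: S) (link A (x |: S))%:R / 'C((n - #|S|).-1, (r - #|S|).-1)%:R.
  apply: eq_bigr => x; rewrite inE => xS.
  by rewrite /density cardsU1 xS add1n !subnS.
rewrite -mulr_suml -natr_sum sum_link_setU1 cC /density.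
have := mul_bin_diag (n - #|S|) (r - #|S|).-1.
rewrite prednK ?subn_gt0 // => /(congr1 (fun k => k%:R : R)); rewrite !natrM => e.
have b0 : 'C(n - #|S|, r - #|S|)%:R != 0 :> R.
  by rewrite pnatr_eq0 -lt0n bin_gt0; lia.
have b1 : 'C((n - #|S|).-1, (r - #|S|).-1)%:R != 0 :> R.
  by rewrite pnatr_eq0 -lt0n bin_gt0; lia.
apply: (mulIf b0); apply: (mulIf b1); rewrite mulrAC mulfVK //.
by rewrite mulrA mulfVK // [RHS]mulrAC e; ring.
Qed.

Lemma mean_square_density (R : realFieldType) A j :
  mean_square (density R A) j =
  (\sum_(S : {set 'I_n} | #|S| == j) link A S ^ 2)%N%:R
    / ('C(n - j, r - j)%:R ^+ 2 * 'C(n, j)%:R).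
Proof.
rewrite /mean_square card_ord natr_sum invfM mulrA; congr (_ / _).
rewrite mulr_suml; apply: eq_bigr => S /eqP cS.
by rewrite /density cS expr_div_n natrX.
Qed.

Lemma mean_square_density0 (R : realFieldType) A :
  mean_square (density R A) 0 = (#|A|%:R / 'C(n, r)%:R) ^+ 2.
Proof.
rewrite mean_square_density !subn0 bin0 mulr1 sum_link_sqr.
under eq_bigr do under eq_bigr do rewrite bin0.
under eq_bigr do rewrite sum1_card.
by rewrite sum_nat_const natrM -expr2 expr_div_n.
Qed.

(** Two distinct [r]-sets meet in fewer than [r] points, so only the diagonal pairs survive in
    [sum_link_sqr]. *)
Lemma mean_square_densityr (R : realFieldType) A :
  mean_square (density R A) r = #|A|%:R / 'C(n, r)%:R.
Proof.
rewrite mean_square_density !subnn bin0 expr1n mul1r sum_link_sqr.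
congr (_%:R / _); rewrite -sum1_card; apply: eq_bigr => v vA.
rewrite (bigD1 v) //= setIid card_supp binn big1 // => w /andP[_ wv].
apply: bin_small; rewrite -[ltnRHS](card_supp w); apply: proper_card.
rewrite properE subsetIr subsetIidr /=.
apply: contra wv => sub; apply/eqP/supp_inj/eqP.
by rewrite eqEcard sub !card_supp /=.
Qed.

Lemma mean_square_density_le (R : realFieldType) A :
    (0 < r)%N -> (s <= r)%N -> (r <= n)%N ->
  mean_square (density R A) s <=
    (1 - s%:R / r%:R) * (#|A|%:R / 'C(n, r)%:R) ^+ 2
    + s%:R / r%:R * (#|A|%:R / 'C(n, r)%:R).
Proof.
move=> r0 sr rn.
rewrite -mean_square_density0 -[in leRHS]mean_square_densityr.
have cvx j : (j.+1 < r)%N -> 2%:R * mean_square (density R A) j.+1 <=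
    mean_square (density R A) j + mean_square (density R A) j.+2.
  move=> jr; apply: (mean_square_convex R _ r); rewrite ?card_ord //.
  exact: harmonic_density.
have := convex_seq_le R (mean_square (density R A)) r s cvx sr.
have r1 : 0 < r%:R :> R by rewrite ltr0n.
rewrite natrB // -(ler_pM2l r1 (mean_square _ s)) => /le_trans; apply.
by rewrite le_eqVlt; apply/predU1P; left; field; rewrite lt0r_neq0.
Qed.

(** * From densities to edges and modularity *)

Lemma mul_bin_binB : (s <= r)%N -> (r <= n)%N ->
  ('C(n, r) * 'C(r, s) = 'C(n, s) * 'C(n - s, r - s))%N.
Proof.
move=> sr rn.
have e1 := bin_fact rn; have e2 := bin_fact sr.
have e3 := bin_fact (leq_trans sr rn).
have e4 := bin_fact (leq_sub2r s rn).
have er : (n - s - (r - s) = n - r)%N by lia.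
rewrite er in e4.
have fp : (0 < s`! * (r - s)`! * (n - r)`!)%N by rewrite !muln_gt0 !fact_gt0.
apply/eqP; rewrite -(eqn_pmul2r fp); apply/eqP.
transitivity n`!; first by rewrite -e1 -e2; ring.
by rewrite -e3 -e4; ring.
Qed.

(* Inverse of the probability that two independent random [r]-supersets of an
   [s]-set meet only in that set. *)
Definition disjointness_ratio (R : realFieldType) : R :=
  'C(n - s, r - s)%:R / 'C(n - r, r - s)%:R.

(** The numerator is bounded by [sum_adj_le]; [disjointness_ratio] is exactly the quotient between
    the normalisation by edges and the one in [mean_square]. *)
Lemma edges_in_johnson_le (R : realFieldType) (A : {set johnson n r s}) :
    (s < r)%N -> (2 * r <= n)%N ->
  #|edges_in A|%:R / #|edges (johnson n r s)|%:R <=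
    disjointness_ratio R * mean_square (density R A) s.
Proof.
move=> sr rn.
have bp a b : (b <= a)%N -> 0 < 'C(a, b)%:R :> R by rewrite ltr0n bin_gt0.
have eE : 2%:R * #|edges (johnson n r s)|%:R =
    'C(n, s)%:R * 'C(n - s, r - s)%:R * 'C(n - r, r - s)%:R :> R.
  by rewrite -!natrM card_edges_johnson // -mul_bin_binB ?mulnA //; lia.
have eA : 2%:R * #|edges_in A|%:R <=
    (\sum_(S : {set 'I_n} | #|S| == s) link A S ^ 2)%N%:R :> R.
  by rewrite -natrM card_edges_in ler_nat sum_adj_le.
rewrite mean_square_density /disjointness_ratio.
have -> : #|edges_in A|%:R / #|edges (johnson n r s)|%:R =
    (2%:R * #|edges_in A|%:R) / (2%:R * #|edges (johnson n r s)|%:R) :> R.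
  by rewrite -mulf_div divff ?mul1r // pnatr_eq0.
rewrite eE.
have p1 := bp n s ltac:(lia); have p2 := bp (n - s)%N (r - s)%N ltac:(lia).
have p3 := bp (n - r)%N (r - s)%N ltac:(lia).
move: ('C(n, s)%:R) ('C(n - s, r - s)%:R) ('C(n - r, r - s)%:R) p1 p2 p3.
move=> x y z x0 y0 z0.
have -> (L : R) : y / z * (L / (y ^+ 2 * x)) = L / (x * y * z).
  by field; rewrite !lt0r_neq0.
by rewrite ler_pM2r // invr_gt0 !mulr_gt0.
Qed.

(** Each part is bounded by a constant times its relative size, and the relative sizes sum to 1. *)
Lemma modularity_johnson_le (R : realFieldType) :
    (s < r)%N -> (2 * r <= n)%N ->
  modularity R (johnson n r s) <=
    disjointness_ratio R * (s%:R / r%:R) + (disjointness_ratio R - 1).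
Proof.
move=> sr rn.
have [P PP ->] := modularity_attained R (johnson n r s).
set rho := disjointness_ratio R; set t : R := s%:R / r%:R.
set N : R := 'C(n, r)%:R.
have N0 : 0 < N by rewrite ltr0n bin_gt0; lia.
have rho1 : 1 <= rho.
  rewrite /rho /disjointness_ratio ler_pdivlMr ?ltr0n ?bin_gt0; last lia.
  by rewrite mul1r ler_nat leq_bin2l //; lia.
have t0 : 0 <= t by rewrite divr_ge0.
pose d := ('C(r, s) * 'C(n - r, r - s))%N.
have d0 : 0 < d%:R :> R by rewrite ltr0n muln_gt0 !bin_gt0; lia.
have eE : 2%:R * #|edges (johnson n r s)|%:R = N * d%:R :> R.
  by rewrite -!natrM card_edges_johnson.
have block (A : {set johnson n r s}) : A \in P ->
    #|edges_in A|%:R / #|edges (johnson n r s)|%:R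
    - (\sum_(v in A) deg v)%N%:R ^+ 2
      / (4%:R * #|edges (johnson n r s)|%:R ^+ 2)
    <= (rho * t + (rho - 1)) * (#|A|%:R / N) :> R.
  move=> AP.
  have -> : (\sum_(v in A) deg v)%N%:R ^+ 2
      / (4%:R * #|edges (johnson n r s)|%:R ^+ 2) = (#|A|%:R / N) ^+ 2 :> R.
    have -> : (\sum_(v in A) deg v = #|A| * d)%N.
      by rewrite -sum_nat_const; apply: eq_bigr => v _; rewrite deg_johnson.
    have -> : 4%:R * #|edges (johnson n r s)|%:R ^+ 2 = (N * d%:R) ^+ 2 :> R.
      by rewrite -eE; ring.
    by rewrite natrM; field; rewrite !lt0r_neq0.
  have := edges_in_johnson_le R A sr rn; rewrite -/rho.
  have r0 : (0 < r)%N by lia.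
  have rn' : (r <= n)%N by lia.
  have := mean_square_density_le R A r0 (ltnW sr) rn'.
  rewrite -/N -/t.
  have AN : #|A|%:R / N <= 1.
    by rewrite ler_pdivrMr // mul1r ler_nat -card_johnson max_card.
  have A0 : 0 <= #|A|%:R / N by rewrite divr_ge0 // ltW.
  move: (mean_square _ _) (_ / _) (#|A|%:R / N) AN A0 => a x mu mu1 mu0 ha hx.
  (* The part contributes at most [rho * t * mu + (rho - 1) * mu ^+ 2 - rho * t * mu ^+ 2]; [h2]
     discards the last term and [h3] replaces [mu ^+ 2] by [mu]. *)
  have h1 : rho * a <= rho * ((1 - t) * mu ^+ 2 + t * mu).
    by rewrite ler_wpM2l //; lra.
  have h2 : 0 <= rho * t * mu ^+ 2 by rewrite !mulr_ge0 ?sqr_ge0 //; lra.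
  have h3 : (rho - 1) * mu ^+ 2 <= (rho - 1) * mu.
    by rewrite ler_wpM2l ?subr_ge0 // expr2 ler_piMr.
  lra.
rewrite /modularity_score -sumrB; apply: (le_trans (ler_sum _ block)).
rewrite -mulr_sumr -mulr_suml -natr_sum -(card_partition PP) cardsT.
by rewrite card_johnson divff ?mulr1 // lt0r_neq0.
Qed.

End JohnsonGraph.

(** * Asymptotics as [n] grows *)

Lemma disjointness_ratio_le (R : realFieldType) (n r s : nat) :
    (s < r)%N -> (2 * r < n)%N -> (2 * r <= n - 2 * r)%N ->
  disjointness_ratio n r s R <=
    1 + 3%:R ^+ (r - s) * ((2 * r)%:R / (n - 2 * r)%:R).
Proof.
move=> sr rn rn2.
have m0 : 0 < (n - 2 * r)%:R :> R by rewrite ltr0n; lia.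
set x : R := (2 * r)%:R / _.
have x0 : 0 <= x by rewrite divr_ge0.
have x1 : x <= 1 by rewrite ler_pdivrMr // mul1r ler_nat.
have -> : disjointness_ratio n r s R =
    ((n - s) ^_ (r - s))%:R / ((n - r) ^_ (r - s))%:R.
  by rewrite -!bin_ffact !natrM -mulf_div divff ?mulr1 // pnatr_eq0 -lt0n fact_gt0.
(* Each of the [r - s] factors of the falling-factorial quotient is at most
   [n / (n - 2 * r) = 1 + x]. The power is then linearised by induction, where [x <= 1] and
   [1 <= 3 ^+ k] let the constant triple at each step. *)
apply: (@le_trans _ _ ((1 + x) ^+ (r - s))); last first.
  elim: (r - s)%N => [|k IH]; first by rewrite expr0 mul1r lerDl.
  have p3 : 1 <= 3%:R ^+ k :> R by rewrite exprn_ege1 // ler1n.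
  have : (1 + x) * (1 + x) ^+ k <= (1 + x) * (1 + 3%:R ^+ k * x).
    by rewrite ler_wpM2l //; lra.
  rewrite -exprS => /le_trans; apply; rewrite exprS.
  move: (3%:R ^+ k) p3 => c c1.
  have : x <= c * x by rewrite ler_peMl.
  have : c * x * x <= c * x by rewrite ler_piMr // mulr_ge0 //; lra.
  lra.
rewrite ler_pdivrMr ?ltr0n ?ffact_gt0; last lia.
have -> : (1 + x) ^+ (r - s) = \prod_(i < r - s) (1 + x).
  by rewrite prodr_const card_ord.
rewrite !ffact_prod !natr_prod -big_split /=.
apply: ler_prod => i _; rewrite ler0n /=.
have -> : 1 + x = n%:R / (n - 2 * r)%:R.
  have nE : n%:R = (n - 2 * r)%:R + (2 * r)%:R :> R by rewrite -natrD subnK // ltnW.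
  by rewrite /x nE mulrDl divff ?lt0r_neq0.
rewrite mulrAC ler_pdivlMr // -!natrM ler_nat leq_mul //; first lia.
by have := ltn_ord i; lia.
Qed.

Theorem corollary3p1p4 (R : realType) (r s : nat) (hs : (1 <= s)%N)
    (hrs : (s < r)%N) :
  (limn_esup (fun n : nat => (modularity R (johnson n r s))%:E)
     <= (s%:R / r%:R)%:E)%E.
Proof.
apply/lee_addgt0Pr => e e0.
(* The excess over [s / r] is [(rho - 1) * (1 + t)], at most [C / (n - 2 * r)] since [t <= 1]; [K]
   exceeds [C / e], so [n - 2 * r >= K] makes it at most [e]. *)
pose C : R := 2%:R * 3%:R ^+ (r - s) * (2 * r)%:R.
pose K := (Num.truncn (C / e)).+1.
pose V := [set n : nat | (K + 4 * r <= n)%N]%classic.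
pose q n := (modularity R (johnson n r s))%:E.
(* The upper limit is an infimum of suprema over neighbourhoods of infinity, so the single
   neighbourhood [V] suffices. *)
apply: (@le_trans _ _ (ereal_sup (q @` V)%classic)).
  apply: ereal_inf_lbound; exists V => //.
  by exists (K + 4 * r)%N.
apply: ge_ereal_sup => _ [n Kn <-].
have {}Kn : (K + 4 * r <= n)%N := Kn.
have rn : (2 * r <= n)%N by lia.
rewrite /q -EFinD lee_fin (le_trans (modularity_johnson_le n r s R hrs rn)) //.
have := disjointness_ratio_le R n r s hrs ltac:(lia) ltac:(lia).
set rho := disjointness_ratio _ _ _ _; set m : R := (n - 2 * r)%:R.
set t : R := s%:R / r%:R => rho_le.
have m0 : 0 < m by rewrite ltr0n; lia.
have t0 : 0 <= t by rewrite divr_ge0.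
have t1 : t <= 1 by rewrite ler_pdivrMr ?ltr0n ?mul1r ?ler_nat; lia.
have Cm : C / m <= e.
  rewrite ler_pdivrMr // mulrC -ler_pdivrMr // (le_trans (ltW (truncnS_gt _))) //.
  by rewrite ler_nat -/K; lia.
set y := 3%:R ^+ (r - s) * ((2 * r)%:R / m) in rho_le.
have yC : C / m = 2%:R * y by rewrite /C /y; field; rewrite lt0r_neq0.
have y0 : 0 <= y by rewrite /y !mulr_ge0 ?invr_ge0 ?exprn_ge0 // ltW.
have : (rho - 1) * (1 + t) <= y * (1 + t) by rewrite ler_wpM2r //; lra.
have : y * (1 + t) <= y * 2%:R by rewrite ler_wpM2l //; lra.
lra.
Qed.
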